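(* Let $m\ge 2$ be an integer, let $1\le p\le\infty$, and let $m'$ and $p'$ be the conjugate exponents of $m$ and $p$ respectively. Then the $m$th polarization constant $\mathbb{C}(m,p)$ of complex $L_p$ spaces satisfies \[ \mathbb{C}(m,p)\le \begin{cases} \dfrac{m^{m/p}}{m!} & \text{if } 1\le p\le m',\\[2mm] \dfrac{m^{m/m'}}{m!} & \text{if } m'\le p\le m,\\[2mm] \dfrac{m^{m/p'}}{m!} & \text{if } m\le p\le\infty. \end{cases} \]
   Context: Conjugate exponents: $q'=q/(q-1)$ for $1<q<\infty$, $1'=\infty$, $\infty'=1$. For a complex Banach space $X$, let $\mathcal{L}^s({}^mX;\mathbb{C})$ be the space of continuous symmetric $m$-linear forms $L:X^m\to\mathbb{C}$, with norm $\|L\|=\sup\{|L(x_1,\dots,x_m)|:\|x_i\|\le 1,\ 1\le i\le m\}$. The associated $m$-homogeneous polynomial is $\widehat{L}(x)=L(x,\dots,x)$, with norm $\|\widehat{L}\|=\sup\{|\widehat{L}(x)|:\|x\|\le 1\}$. The $m$th polarization constant of $X$ is \[ \mathbb{C}(m,X)=\inf\{M>0:\ \|L\|\le M\|\widehat{L}\|\ \text{ for all } L\in\mathcal{L}^s({}^mX;\mathbb{C})\}, \] and $\mathbb{C}(m,p)=\sup\{\mathbb{C}(m,L_p(\mu)):\ \mu \text{ is a measure}\}$, where $L_p(\mu)$ is the complex space. *)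

(* Defs.v *)
From HB Require Import structures.
From mathcomp Require Import all_boot all_order all_algebra.
From mathcomp Require Import perm ring_quotient complex.
From mathcomp Require Import all_classical all_reals all_analysis.
From mathcomp Require Import ess_sup_inf measurable_realfun.

Set Implicit Arguments.
Unset Strict Implicit.
Unset Printing Implicit Defensive.

Import Order.TTheory GRing.Theory Num.Theory.
Import numFieldNormedType.Exports.
Import ComplexField.Normc.

Local Open Scope classical_set_scope.
Local Open Scope ring_scope.
Local Open Scope complex_scope.
Local Open Scope quotient_scope.

(* [all_algebra] also defines [Re] and [Im], for numClosedFieldType's *)
Local Notation Re := (@complex.Re _).
Local Notation Im := (@complex.Im _).
Local Notation normc := (@ComplexField.Normc.normc _).

Section polarization.
Context {R : realType}.
Variables (m : nat) (X : normedModType R[i]).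
Implicit Types L : ('I_m -> X) -> R[i].

(* [dfwith v i x] is the tuple [v] with its [i]th entry replaced by [x];
   [scalar] means linear with values in the field *)
Definition multilinear L :=
  forall (v : 'I_m -> X) (i : 'I_m), scalar (fun x : X => L (dfwith v i x)).

Definition symmetric_form L :=
  forall (s : 'S_m) (v : 'I_m -> X), L (v \o s) = L v.

(* [{ptws 'I_m -> X}] is X^m with the product topology, and [R[i]^o] is the
   field R[i] with the topology of its norm *)
Definition sym_forms : set (('I_m -> X) -> R[i]) :=
  [set L | [/\ continuous (L : {ptws 'I_m -> X} -> R[i]^o),
               multilinear L & symmetric_form L]].

Definition assoc_poly L (x : X) : R[i] := L (fun=> x).

(* The suprema and the infimum below are taken in \bar R, so that no default
   value is ever used; [normc] is the modulus as an element of R, whereas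
   [`|x|] is a nonnegative real element of R[i]. *)
Definition form_norm L : \bar R :=
  ereal_sup [set (normc (L v))%:E | v in [set v | forall i, `|v i| <= 1]].

Definition poly_norm (P : X -> R[i]) : \bar R :=
  ereal_sup [set (normc (P x))%:E | x in [set x | `|x| <= 1]].

Definition polarization_constant : \bar R :=
  ereal_inf [set M%:E | M in [set M : R | 0 < M /\
    forall L, sym_forms L ->
      (form_norm L <= M%:E * poly_norm (assoc_poly L))%E]].

End polarization.
Arguments polarization_constant {R} m X.

Section complex_Lfun.
Context d (T : measurableType d) (R : realType).
Variables (mu : {measure set T -> \bar R}) (p : \bar R).

(* A complex-valued function is measurable when its real and imaginary parts
   are. *)
Definition cmeasurable_fun (f : T -> R[i]) :=
  measurable_fun [set: T] (Re \o f) /\ measurable_fun [set: T] (Im \o f).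

Definition cLnorm (f : T -> R[i]) : \bar R := 'N[mu]_p[EFin \o (normc \o f)].

(* The proof of 1 <= p does not occur in the set, but indexing by it lets the
   vector space structure be inferred. *)
Definition cLfun of (1 <= p)%E : {pred (T -> R[i])} :=
  mem [set f | cmeasurable_fun f /\ (cLnorm f < +oo)%E].

End complex_Lfun.

Section complex_Lfun_theory.
Context d (T : measurableType d) (R : realType).
Variables (mu : {measure set T -> \bar R}) (p : \bar R) (p1 : (1 <= p)%E).
Implicit Types (f g : T -> R[i]) (a : R[i]).

Lemma complex_ReD (x y : R[i]) : Re (x + y) = Re x + Re y.
Proof. by case: x y => ? ? []. Qed.
Lemma complex_ImD (x y : R[i]) : Im (x + y) = Im x + Im y.
Proof. by case: x y => ? ? []. Qed.
Lemma complex_ReM (x y : R[i]) : Re (x * y) = Re x * Re y - Im x * Im y.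
Proof. by case: x y => ? ? []. Qed.
Lemma complex_ImM (x y : R[i]) : Im (x * y) = Re x * Im y + Im x * Re y.
Proof. by case: x y => ? ? []. Qed.

Lemma normc_ge0 (x : R[i]) : 0 <= normc x.
Proof. by case: x => a b; exact: sqrtr_ge0. Qed.

Lemma cmeasurable_funD f g :
  cmeasurable_fun f -> cmeasurable_fun g -> cmeasurable_fun (f + g).
Proof.
move=> [rf mf] [rg mg]; split.
  rewrite (_ : _ \o _ = (Re \o f) \+ (Re \o g)); first exact: measurable_funD.
  by apply/funext => x /=; rewrite complex_ReD.
rewrite (_ : _ \o _ = (Im \o f) \+ (Im \o g)); first exact: measurable_funD.
by apply/funext => x /=; rewrite complex_ImD.
Qed.

Lemma cmeasurable_funZ a f : cmeasurable_fun f -> cmeasurable_fun (a *: f).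
Proof.
move=> [rf mf]; split.
  rewrite (_ : _ \o _ =
    (cst (Re a) \* (Re \o f)) \- (cst (Im a) \* (Im \o f))).
    by apply: measurable_funB; apply: measurable_funM.
  by apply/funext => x /=; rewrite -complex_ReM.
rewrite (_ : _ \o _ = (cst (Re a) \* (Im \o f)) \+ (cst (Im a) \* (Re \o f))).
  by apply: measurable_funD; apply: measurable_funM.
by apply/funext => x /=; rewrite -complex_ImM.
Qed.

Lemma measurable_normc f :
  cmeasurable_fun f -> measurable_fun [set: T] (normc \o f).
Proof.
move=> [rf mf].
rewrite (_ : _ \o _ = (fun x => ((Re \o f) x ^+ 2 + (Im \o f) x ^+ 2) `^ 2^-1)).
  apply: (measurableT_comp (measurable_powR _)).
  by apply: measurable_funD; apply: measurable_funX.
by apply/funext => x /=; rewrite powR12_sqrt ?addr_ge0 ?sqr_ge0//; case: (f x).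
Qed.

Lemma ae_le_Lnorm (u v : T -> R) :
  measurable_fun [set: T] u -> measurable_fun [set: T] v ->
  {ae mu, forall x, `|u x| <= `|v x|} ->
  ('N[mu]_p[EFin \o u] <= 'N[mu]_p[EFin \o v])%E.
Proof.
move=> mu_ mv uv; rewrite unlock /Lnorm.
case: p p1 => [r r1| _|//].
  have r0 : (0 <= r)%R by rewrite -lee_fin (le_trans _ r1).
  have mpow (w : T -> R) : measurable_fun [set: T] w ->
      measurable_fun [set: T] (fun x => (`|w x| `^ r)%:E).
    move=> mw; apply/measurable_EFinP; apply: (measurableT_comp (measurable_powR _)).
    exact: measurableT_comp.
  have ipow (w : T -> R) : (0 <= \int[mu]_x (`|w x| `^ r)%:E)%E.
    by apply: integral_ge0 => x _; rewrite lee_fin powR_ge0.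
  apply: gt0_ler_poweR; rewrite ?invr_ge0 ?in_itv/= ?leey ?andbT//; try exact: ipow.
  apply: ae_ge0_le_integral => //; try exact: mpow.
  by apply: filterS uv => x uvx _; rewrite lee_fin ge0_ler_powR.
case: ifPn => // _; apply: le_ess_sup.
by apply: filterS uv => x uvx /=; rewrite lee_fin.
Qed.

Lemma eq_ae_cLnorm f g : cmeasurable_fun f -> cmeasurable_fun g ->
  f = g %[ae mu] -> cLnorm mu p f = cLnorm mu p g.
Proof.
move=> mf mg fg; apply/eqP; rewrite eq_le; apply/andP; split.
  apply: ae_le_Lnorm; [exact: measurable_normc|exact: measurable_normc|].
  by apply: filterS fg => x /= /(_ I) ->.
apply: ae_le_Lnorm; [exact: measurable_normc|exact: measurable_normc|].
by apply: filterS fg => x /= /(_ I) ->.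
Qed.

Lemma cLnormD f g : cmeasurable_fun f -> cmeasurable_fun g ->
  (cLnorm mu p (f + g)%R <= cLnorm mu p f + cLnorm mu p g)%E.
Proof.
move=> mf mg; have mnf := measurable_normc mf; have mng := measurable_normc mg.
apply: le_trans (eminkowski mu mnf mng p1).
apply: ae_le_Lnorm; [exact/measurable_normc/cmeasurable_funD|exact: measurable_funD|].
apply/aeW => x /=.
rewrite ger0_norm ?normc_ge0// ger0_norm ?addr_ge0 ?normc_ge0//.
exact: le_normcD.
Qed.

Lemma cLfun_Lfun f : f \in cLfun mu p1 -> normc \o f \in Lfun mu p.
Proof.
rewrite inE /= => -[mf lf]; rewrite inE; apply/andP; split; rewrite inE//=.
exact: measurable_normc.
Qed.

Lemma cLnormZ a f : f \in cLfun mu p1 ->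
  cLnorm mu p (a *: f) = ((normc a)%:E * cLnorm mu p f)%E.
Proof.
move=> /cLfun_Lfun fL; have := LnormZ (Lfun_Sub p1 fL) (normc a).
rewrite ger0_norm ?normc_ge0// => <-; congr Lnorm.
apply/funext => x; congr EFin; exact: normcM.
Qed.

Lemma cLfun_submod_closed : submod_closed (cLfun mu p1).
Proof.
have c0 : (0 : T -> R[i]) \in cLfun mu p1.
  rewrite inE /=; split; first by split; exact: measurable_cst.
  rewrite /cLnorm (_ : EFin \o _ = cst 0%E) ?Lnorm0 ?gt_eqF ?(lt_le_trans _ p1)//.
  by apply/funext => x; congr EFin; exact: normc0.
split => // a f g fL gL.
have := fL; have := gL; rewrite !inE /= => -[mg lg] [mf lf]; split.
  exact/cmeasurable_funD/mg/cmeasurable_funZ.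
apply: le_lt_trans (cLnormD (cmeasurable_funZ a mf) mg) _.
rewrite lte_add_pinfty// cLnormZ// lte_mul_pinfty ?lee_fin ?normc_ge0//.
Qed.

End complex_Lfun_theory.

Section complex_Lspace.
Context d (T : measurableType d) (R : realType).
Variables (mu : {measure set T -> \bar R}) (p : \bar R) (p1 : (1 <= p)%E).

HB.instance Definition _ := GRing.isSubmodClosed.Build _ _ (cLfun mu p1)
  (cLfun_submod_closed mu p1).

Record cLfunType := CLfun { cLfun_val :> T -> R[i];
                            cLfun_valP : cLfun_val \in cLfun mu p1 }.

HB.instance Definition _ := [isSub for cLfun_val].
HB.instance Definition _ := [Choice of cLfunType by <:].
HB.instance Definition _ := [SubChoice_isSubLmodule of cLfunType by <:].

Definition ae_null : {pred cLfunType} :=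
  mem [set f : cLfunType | cLfun_val f = 0 %[ae mu]].

Lemma cLfun_measurable (f : cLfunType) : cmeasurable_fun f.
Proof. by have := cLfun_valP f; rewrite inE => -[]. Qed.

Lemma ae_null_submod_closed : submod_closed ae_null.
Proof.
split; first by rewrite inE /=; apply: aeW.
move=> a f g; rewrite !inE /= => f0 g0.
apply: filterS2 f0 g0 => x fx gx _.
rewrite -[LHS]/(a * cLfun_val f x + cLfun_val g x) fx// gx//.
by rewrite mulr0 addr0.
Qed.

HB.instance Definition _ := GRing.isSubmodClosed.Build _ _ ae_null
  ae_null_submod_closed.

(* The complex space L_p(mu), 1 <= p <= +oo, for an arbitrary measure:
   a.e. classes of p-integrable (essentially bounded if p = +oo) functions. Its
   norm takes values in R[i], as the norm of any normedModType over R[i]. *)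
Definition cLspace := Quotient.quot ae_null.

HB.instance Definition _ := GRing.Zmodule.on cLspace.
HB.instance Definition _ := EqQuotient.on cLspace.

Lemma cLspace_eqP (f g : cLfunType) :
  reflect (cLfun_val f = cLfun_val g %[ae mu]) (f == g %[mod cLspace]).
Proof.
rewrite -Quotient.idealrBE; apply: (iffP idP); rewrite inE /= => fg.
  apply: filterS fg => x /= fgx _; apply/eqP; rewrite -subr_eq0; apply/eqP.
  exact: fgx.
apply: filterS fg => x /= fgx _.
by rewrite -[LHS]/(cLfun_val f x - cLfun_val g x) fgx// subrr.
Qed.

Definition cLspace_scale (a : R[i]) : cLspace -> cLspace :=
  lift_op1 cLspace ( *:%R a).

Lemma pi_cLspace_scale a :
  {morph \pi_cLspace : f / a *: f >-> cLspace_scale a f}.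
Proof.
move=> f; unlock cLspace_scale; apply/eqP/cLspace_eqP.
have /cLspace_eqP : f == repr (\pi_cLspace f) %[mod cLspace] by rewrite reprK.
by apply: filterS => x fx _; exact: (congr1 (fun z => a * z) (fx I)).
Qed.
Canonical pi_cLspace_scale_morph a := PiMorph1 (pi_cLspace_scale a).

Lemma cLspace_scaleA a b x :
  cLspace_scale a (cLspace_scale b x) = cLspace_scale (a * b) x.
Proof. by rewrite -[x]reprK !piE scalerA. Qed.

Lemma cLspace_scale1 : left_id 1 cLspace_scale.
Proof. by move=> x; rewrite -[x]reprK !piE scale1r. Qed.

Lemma cLspace_scaleDr : right_distributive cLspace_scale +%R.
Proof. by move=> a x y; rewrite -[x]reprK -[y]reprK !piE scalerDr. Qed.

Lemma cLspace_scaleDl x : {morph cLspace_scale^~ x : a b / a + b}.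
Proof. by move=> a b; rewrite -[x]reprK !piE scalerDl. Qed.

HB.instance Definition _ := GRing.Zmodule_isLmodule.Build R[i] cLspace
  cLspace_scaleA cLspace_scale1 cLspace_scaleDr cLspace_scaleDl.

Definition cLspace_norm (x : cLspace) : R[i] :=
  (fine (cLnorm mu p (repr x)))%:C.

Lemma cLnorm_fin_num (f : cLfunType) : cLnorm mu p f \is a fin_num.
Proof.
by rewrite ge0_fin_numE ?Lnorm_ge0//; have := cLfun_valP f; rewrite inE => -[].
Qed.

Lemma cLspace_normE (f : cLfunType) :
  cLspace_norm (\pi_cLspace f) = (fine (cLnorm mu p f))%:C.
Proof.
congr (fine _)%:C; apply: eq_ae_cLnorm => //; [exact: cLfun_measurable..|].
by apply/cLspace_eqP; rewrite reprK.
Qed.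

Lemma cLspace_ler_normD x y :
  cLspace_norm (x + y) <= cLspace_norm x + cLspace_norm y.
Proof.
rewrite -[x]reprK -[y]reprK.
have -> : \pi_cLspace (repr x) + \pi_cLspace (repr y) =
  \pi_cLspace (repr x + repr y) by rewrite !piE.
rewrite !cLspace_normE -rmorphD lecR.
rewrite -lee_fin EFinD !fineK ?cLnorm_fin_num//.
by apply: cLnormD => //; exact: cLfun_measurable.
Qed.

Lemma cLspace_normrZ a x : cLspace_norm (a *: x) = `|a| * cLspace_norm x.
Proof.
rewrite -[x]reprK -[_ *: _]/(cLspace_scale a _) -pi_cLspace_scale.
rewrite !cLspace_normE.
have -> : `|a| = (normc a)%:C by case: a.
rewrite -rmorphM; congr (_%:C); apply: EFin_inj.
rewrite EFinM !fineK ?cLnorm_fin_num//.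
by rewrite -(cLnormZ a (cLfun_valP _)).
Qed.

Lemma cLspace_norm0_eq0 x : cLspace_norm x = 0 -> x = 0.
Proof.
rewrite -[x]reprK cLspace_normE => -[].
move=> f0; have -> : 0 = \pi_cLspace 0 by rewrite !piE.
apply/eqP/cLspace_eqP.
have /Lnorm_eq0_eq0 : cLnorm mu p (repr x) = 0%E.
  by rewrite -[LHS]fineK ?cLnorm_fin_num// f0.
have mn : measurable_fun setT (EFin \o (normc \o repr x)).
  exact/measurable_EFinP/measurable_normc/cLfun_measurable.
move=> /(_ mn (lt_le_trans lte01 p1)).
by apply: filterS => t /= tx _; apply: eq0_normc; case: (tx I).
Qed.

HB.instance Definition _ := Lmodule_isNormed.Build R[i] cLspace
  cLspace_ler_normD cLspace_normrZ cLspace_norm0_eq0.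

End complex_Lspace.

Definition polarization_constant_Lp (R : realType) (m : nat) (p : \bar R)
    (p1 : (1 <= p)%E) : \bar R :=
  ereal_sup [set c | exists d (T : measurableType d)
    (mu : {measure set T -> \bar R}),
      c = polarization_constant m (cLspace mu p1)].

(* Main.v *)
(* For real s > 1 with conjugate exponent q, let S = sum_i e_i x_i with
   independent random signs e_i. Clarkson's inequality
     |x + y|^q + |x - y|^q <= 2 (|x|^s + |y|^s)^(q-1)
   holds in L_p whenever s <= p <= q, by Minkowski's inequality from the scalar
   case. Adding one vector at a time gives E|S|^q <= m^(q/s) for x_1, ..., x_m
   in the unit ball, hence E|S|^m <= m^(m/s) if m <= q, and the polarization
   formula m! L(x_1, ..., x_m) = E[e_1 ... e_m L(S, ..., S)] bounds the
   polarization constant by m^(m/s) / m!. The three cases are s = p, s = m' and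
   s = p'; when this gives s = 1, |S| <= m is enough.

   The scalar case reduces to (1+x)^q + (1-x)^q <= 2 (1+x^s)^(q-1) on [0, 1],
   with equality at both ends. At an interior minimum of the difference, the
   vanishing of the derivative, together with a negative value, contradicts the
   inequalities of Gibbs and Jensen for the logarithm. *)
Require Import Defs.
From mathcomp Require Import all_boot all_order all_algebra.
From mathcomp Require Import all_classical all_reals all_analysis.
From mathcomp Require Import ring lra.
From mathcomp Require Import perm ring_quotient complex measurable_realfun.
Import Order.TTheory GRing.Theory Num.Theory.
Import numFieldNormedType.Exports.
Local Open Scope classical_set_scope.
Local Open Scope ring_scope.

Set Implicit Arguments.
Unset Strict Implicit.
Unset Printing Implicit Defensive.

Local Notation normc := (@ComplexField.Normc.normc _).

(** * Clarkson's inequality for complex numbers *)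

Lemma continuous_normr_powR (R : realType) (r : R) :
  0 < r -> continuous (fun x : R => `|x| `^ r).
Proof.
move=> r0 x; have [->|x0] := eqVneq x 0.
  apply/cvgrPdist_lt => e e0; rewrite normr0 powR0 ?gt_eqF//.
  near=> y; rewrite sub0r normrN ger0_norm ?powR_ge0//.
  rewrite -[ltRHS]powRr1 ?ltW// -(mulVf (lt0r_neq0 r0)) powRrM.
  apply: gt0_ltr_powR; rewrite ?nnegrE ?powR_ge0//.
  near: y; apply: cvgr0_norm_lt; last by rewrite powR_gt0.
  exact: cvg_id.
apply: (@continuous_comp R R R (fun z => `|z|) (fun z => z `^ r)).
  exact: norm_continuous.
apply/differentiable_continuous/derivable1_diffP/ex_derive.
by apply: is_derive1_powR; rewrite normr_gt0.
Unshelve. all: by end_near. Qed.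

Lemma ler_ln_subr1 (R : realType) (t : R) : 0 < t -> ln t <= t - 1.
Proof. by move=> t0; have := @le_ln1Dx R (t - 1); rewrite [1 + _]addrC subrK; apply; lra. Qed.

(* Gibbs and Jensen are used with the weights [(1 +/- y) / 2]; [A <= B] is the
   former. *)
Lemma critical_point_bound (R : realType) (r x y : R) :
  1 <= r -> 0 < x < 1 -> 0 < y < 1 ->
  (1 + x * y) `^ (r - 1) * (1 + y) < (1 + x) `^ r ->
  (1 + x * y) `^ (r - 1) * (1 - y) < (1 - x) `^ r -> False.
Proof.
move=> r1 /andP[x0 x1] /andP[y0 y1] h1 h2.
have xy0 : 0 < x * y by rewrite mulr_gt0.
have P0 : 0 < 1 + x * y by lra.
have l1 : (r - 1) * ln (1 + x * y) + ln (1 + y) < r * ln (1 + x).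
  rewrite -!ln_powR -lnM ?posrE ?powR_gt0 ?addr_gt0//.
  by rewrite ltr_ln ?posrE ?mulr_gt0 ?powR_gt0 ?addr_gt0.
have l2 : (r - 1) * ln (1 + x * y) + ln (1 - y) < r * ln (1 - x).
  rewrite -!ln_powR -lnM ?posrE ?powR_gt0 ?subr_gt0//.
  by rewrite ltr_ln ?posrE ?mulr_gt0 ?powR_gt0 ?subr_gt0.
have lnD (a b : R) : 0 < a -> 0 < b -> b * (ln a - ln b) <= a - b.
  move=> a0 b0; rewrite -ln_div ?posrE//.
  have := ler_ln_subr1 (divr_gt0 a0 b0); rewrite -(ler_pM2l b0) => /le_trans; apply.
  by rewrite mulrBr mulr1 mulrC divfK// gt_eqF.
have g1 := lnD _ _ (ltr_wpDr (ltW x0) ltr01) (ltr_wpDr (ltW y0) ltr01).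
have x1' : 0 < 1 - x by lra.
have y1' : 0 < 1 - y by lra.
have y1p : 0 < 1 + y by lra.
have g2 := lnD _ _ x1' y1'.
have jen (a : R) : 0 < a -> ln a - ln (1 + x * y) <= a / (1 + x * y) - 1.
  by move=> a0; rewrite -ln_div ?posrE// ler_ln_subr1 ?divr_gt0.
have j1 := jen _ (ltr_wpDr (ltW x0) ltr01); have j2 := jen _ x1'.
set A := (1 + y) * ln (1 + x) + (1 - y) * ln (1 - x).
set B := (1 + y) * ln (1 + y) + (1 - y) * ln (1 - y).
have AB : A <= B by rewrite /A /B; lra.
(* The mean of [1 + x] and [1 - x] for these weights is [1 + x * y], so the tangent-line bounds add
   up to [0]. *)
have Aln : A <= 2 * ln (1 + x * y).
  have : (1 + y) * (ln (1 + x) - ln (1 + x * y)) +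
         (1 - y) * (ln (1 - x) - ln (1 + x * y)) <=
         (1 + y) * ((1 + x) / (1 + x * y) - 1) +
         (1 - y) * ((1 - x) / (1 + x * y) - 1).
    by apply: lerD; rewrite ler_pM2l.
  have -> : (1 + y) * ((1 + x) / (1 + x * y) - 1) +
         (1 - y) * ((1 - x) / (1 + x * y) - 1) = 0.
    by field; rewrite gt_eqF.
  by rewrite /A; lra.
(* The weighted sum of [l1] and [l2]; combined with [Aln] it yields [B < A], against [AB]. *)
have : (r - 1) * (2 * ln (1 + x * y)) + B < r * A.
  rewrite -(ltr_pM2l y1p) in l1; rewrite -(ltr_pM2l y1') in l2.
  by rewrite /A /B; lra.
have : (r - 1) * A <= (r - 1) * (2 * ln (1 + x * y)) by rewrite ler_wpM2l ?subr_ge0.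
by lra.
Qed.

Lemma clarkson_unit (R : realType) (q s x : R) :
  2 <= q -> s = q / (q - 1) -> 0 <= x <= 1 ->
  (1 + x) `^ q + (1 - x) `^ q <= 2 * (1 + x `^ s) `^ (q - 1).
Proof.
move=> q2 sE /andP[x0 x1].
pose r := q - 1; have r1 : 1 <= r by rewrite /r; lra.
have r0 : 0 < r by lra.
have rn0 : r != 0 by rewrite gt_eqF.
have s0 : 0 < s by rewrite sE divr_gt0//; lra.
pose g := fun x : R => (1 + x `^ s) `^ r - 2^-1 * ((1 + x) `^ q + (1 - x) `^ q).
suff : 0 <= g x by rewrite /g -/r; lra.
have cg : {within `[0, 1]%classic, continuous g}.
  (* A function continuous on all of [R] that agrees with [g] on the unit interval. *)
  pose G := fun x : R => `|1 + `|x| `^ s| `^ r -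
    2^-1 * (`|1 + x| `^ q + `|1 - x| `^ q).
  apply: (@subspace_eq_continuous _ _ _ G).
    move=> z; rewrite inE /= in_itv /= => /andP[z0 z1].
    have P0 := powR_ge0 z s.
    by rewrite /G /g !ger0_norm//; lra.
  apply: continuous_subspaceT => z.
  have q0 : 0 < q by lra.
  have cpow (f : R -> R) e : 0 < e -> {for z, continuous f} ->
      {for z, continuous (fun t => `|f t| `^ e)}.
    move=> e0 cf.
    exact: (@continuous_comp R R R f (fun t => `|t| `^ e) z cf
      (@continuous_normr_powR R e e0 (f z))).
  rewrite /G /continuous_at; apply: cvgB.
    by apply: cpow => //; apply: cvgD; [exact: cvg_cst|exact: continuous_normr_powR].
  apply: cvgM; first exact: cvg_cst.
  apply: cvgD; apply: cpow => //.
    by apply: cvgD; [exact: cvg_cst|exact: cvg_id].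
  by apply: cvgB; [exact: cvg_cst|exact: cvg_id].
have [c] := EVT_min ler01 cg; rewrite in_itv /= => /andP[c0 c1] cmin.
rewrite leNgt; apply/negP => gx0.
have gc0 : g c < 0 by apply: le_lt_trans gx0; apply: cmin; rewrite in_itv /= x0.
have {c0} : 0 < c.
  rewrite lt_neqAle c0 andbT; apply/eqP => c0'; move: gc0.
  by rewrite /g -c0' powR0 ?gt_eqF// addr0 subr0 !powR1; lra.
have {c1} : c < 1.
  rewrite lt_neqAle c1 andbT; apply/eqP => c1'; move: gc0.
  rewrite c1' /g !powR1 subrr powR0; last by rewrite gt_eqF//; lra.
  rewrite -(@mulr_powRB1 _ (1 + 1) q) -/r//; last by lra.
  by lra.
move=> c1 c0.
(* Since [s = 1 + r^-1], this choice gives [c]^ s = c * y[and]c [^ (s - 1) = y], so that [s]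
   disappears from the critical equation. *)
pose y := c `^ r^-1.
have yr : y `^ r = c by rewrite /y -powRrM mulVf// powRr1// ltW.
have y0 : 0 < y by rewrite powR_gt0.
have y1 : y < 1.
  have : y < 1 `^ r^-1 by rewrite gt0_ltr_powR ?invr_gt0 ?nnegrE ?ltW.
  by rewrite powR1.
have csE : c `^ s = c * y.
  have -> : s = 1 + r^-1 by rewrite sE -/r -[q](subrK 1) -/r; field.
  by rewrite powRD ?powRr1// ?ltW// (gt_eqF c0) implybT.
have yE : c `^ r^-1 = y by [].
clearbody y.
have dg (z : R) : z \in `]0, 1[%R -> is_derive z 1 g
   (r * (1 + z `^ s) `^ (r - 1) * (s * z `^ (s - 1)) -
    2^-1 * (q * (1 + z) `^ r - q * (1 - z) `^ r)).
  rewrite in_itv /= => /andP[z0 z1].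
  have d1 : is_derive z 1 (fun x => (1 + x `^ s) `^ r)
     (r * (1 + z `^ s) `^ (r - 1) * (s * z `^ (s - 1))).
    apply: (@is_derive1_comp _ (fun x => x `^ r) (fun x => 1 + x `^ s)).
      by apply: is_derive1_powR; rewrite ltr_pwDl ?powR_ge0.
    rewrite -[X in is_derive _ _ _ X]add0r.
    by apply: is_deriveD; apply: is_derive1_powR.
  have d2 : is_derive z 1 (fun x => (1 + x) `^ q) (q * (1 + z) `^ r).
    rewrite -[X in is_derive _ _ _ X]mulr1.
    apply: (@is_derive1_comp _ (fun x => x `^ q) (fun x => 1 + x)).
      by apply: is_derive1_powR; lra.
    by rewrite -[X in is_derive _ _ _ X]add0r; apply: is_deriveD.
  have d3 : is_derive z 1 (fun x => (1 - x) `^ q) (- (q * (1 - z) `^ r)).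
    rewrite -[X in is_derive _ _ _ X]mulrN1.
    apply: (@is_derive1_comp _ (fun x => x `^ q) (fun x => 1 - x)).
      by apply: is_derive1_powR; lra.
    by rewrite -[X in is_derive _ _ _ X]sub0r; apply: is_deriveB.
  exact: (is_deriveB d1 (is_deriveZ 2^-1 (is_deriveD d2 d3))).
have cI : c \in `]0, 1[%R by rewrite in_itv /= c0.
have := @derive1_at_min _ g 0 1 c ler01.
move=> /(_ (fun t tI => @ex_derive _ _ _ _ _ _ _ (dg t tI)) cI) [].
  by move=> t /subset_itv_oo_cc; exact: cmin.
move=> _; have [_ ->] := dg c cI.
have -> : s - 1 = r^-1 by rewrite sE -/r -[q](subrK 1) -/r; field.
rewrite yE csE => crit.
have rsq : r * s = q by rewrite sE -/r mulrC divfK.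
set K := (1 + c * y) `^ (r - 1) in crit.
set U := (1 + c) `^ r in crit; set V := (1 - c) `^ r in crit.
have q0 : q != 0 by rewrite gt_eqF//; lra.
have UV : U - V = 2 * (K * y).
  apply: (mulfI q0).
  have -> : q * (2 * (K * y)) = 2 * (r * K * (s * y)) by rewrite -{1}rsq; ring.
  by move: crit; lra.
have PK : (1 + c * y) `^ r = (1 + c * y) * K.
  by rewrite /K (@mulr_powRB1 _ (1 + c * y) r)// addr_ge0// mulr_ge0// ltW.
have Uq : (1 + c) `^ q = (1 + c) * U by rewrite /U (@mulr_powRB1 _ (1 + c) q)//; lra.
have Vq : (1 - c) `^ q = (1 - c) * V by rewrite /V (@mulr_powRB1 _ (1 - c) q)//; lra.
(* In [g c < 0] the part [2^-1 * c * (U - V)] equals [c * y * K] by [UV] and cancels. Adding and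
   subtracting half of [UV] then gives the two hypotheses of [critical_point_bound]. *)
have KUV : K < 2^-1 * (U + V).
  by move: gc0; rewrite /g csE PK Uq Vq; nra.
apply: (@critical_point_bound _ r c y) => //; rewrite ?c0 ?y0// -/K.
  by rewrite -/U; lra.
by rewrite -/V; lra.
Qed.

Lemma powR_conv (R : realType) (t l x y : R) :
  1 <= t -> 0 <= l <= 1 -> 0 <= x -> 0 <= y ->
  (l * x + (1 - l) * y) `^ t <= l * x `^ t + (1 - l) * y `^ t.
Proof.
move=> t1 /andP[l0 l1] x0 y0.
have := @convex_powR R t t1 (Itv01 l0 l1) x y.
by rewrite !inE /= !in_itv /= !andbT => /(_ x0 y0); rewrite !convRE.
Qed.

(** Radon's inequality: convexity of the power [t] at the points [x / a] and [y / b] with weights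
    [a / (a + b)] and [b / (a + b)]. It is an equality when the two points coincide, which guides
    the choice of [a] and [b] below. *)
Lemma powRD_jensen (R : realType) (t a b x y : R) :
  1 <= t -> 0 < a -> 0 < b -> 0 <= x -> 0 <= y ->
  (x + y) `^ t <= (a + b) `^ (t - 1) * (x `^ t / a `^ (t - 1) + y `^ t / b `^ (t - 1)).
Proof.
move=> t1 a0 b0 x0 y0.
have ab0 : 0 < a + b by rewrite addr_gt0.
have t0 : 0 < t by lra.
have split (c z : R) : 0 < c -> 0 <= z ->
    c * (z / c) `^ t = z `^ t / c `^ (t - 1).
  move=> c0 z0; rewrite powRM ?invr_ge0 ?(ltW c0)// -powR_inv1 ?(ltW c0)//.
  rewrite -powRrM mulN1r powRN -(@mulr_powRB1 _ c t) ?(ltW c0)//.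
  have cn0 : c != 0 by rewrite gt_eqF.
  have cp0 : c `^ (t - 1) != 0 by rewrite gt_eqF// powR_gt0.
  by field; rewrite cn0 cp0.
have := @powR_conv R t (a / (a + b)) (x / a) (y / b) t1.
have -> : 1 - a / (a + b) = b / (a + b) by field; rewrite gt_eqF.
rewrite divr_ge0 ?(ltW a0) ?(ltW ab0)//= ler_pdivrMr// mul1r lerDl (ltW b0).
move=> /(_ isT (divr_ge0 x0 (ltW a0)) (divr_ge0 y0 (ltW b0))).
have -> : a / (a + b) * (x / a) + b / (a + b) * (y / b) = (x + y) / (a + b).
  by field; rewrite !gt_eqF.
rewrite -(ler_pM2l ab0) split ?addr_ge0// ler_pdivrMr ?powR_gt0// => /le_trans; apply.
have abn0 : a + b != 0 by rewrite gt_eqF.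
rewrite -!split//.
rewrite le_eqVlt; apply/orP; left; apply/eqP.
by field; rewrite abn0.
Qed.

(** The points [P + w] and [P - w] are convex combinations of [P + W] and [P - W] with exchanged
    weights [l] and [1 - l]; the two convexity inequalities are added. *)
Lemma powRD_symm_le (R : realType) (t P w W : R) :
  1 <= t -> `|w| <= W -> W <= P ->
  (P + w) `^ t + (P - w) `^ t <= (P + W) `^ t + (P - W) `^ t.
Proof.
move=> t1 wW WP; have : 0 <= W by apply: le_trans wW.
rewrite le_eqVlt => /predU1P[W0|W0].
  by move: wW; rewrite -W0 normr_le0 => /eqP ->.
have [wW1 wW2] : - W <= w /\ w <= W by apply/andP; rewrite -ler_norml.
pose l := (W + w) / (2 * W).
have W20 : 0 < 2 * W by lra.
have l01 : 0 <= l <= 1.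
  by rewrite /l divr_ge0 ?(ltW W20)//= ?ler_pdivrMr// ?mul1r; lra.
have P1 : 0 <= P + W by lra.
have P2 : 0 <= P - W by lra.
have h1 := powR_conv t1 l01 P1 P2; have h2 := powR_conv t1 l01 P2 P1.
have e1 : l * (P + W) + (1 - l) * (P - W) = P + w.
  by rewrite /l; field; rewrite gt_eqF.
have e2 : l * (P - W) + (1 - l) * (P + W) = P - w.
  by rewrite /l; field; rewrite gt_eqF.
by rewrite e1 in h1; rewrite e2 in h2; lra.
Qed.

Lemma clarkson_nonneg (R : realType) (q s a b : R) :
  2 <= q -> s = q / (q - 1) -> 0 <= a -> 0 <= b ->
  (a + b) `^ q + `|a - b| `^ q <= 2 * (a `^ s + b `^ s) `^ (q - 1).
Proof.
move=> q2 sE; wlog ba : a b / b <= a => [hw a0 b0|].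
  have [/hw|/ltW/hw] := leP b a; first exact.
  by rewrite (addrC a) distrC (addrC (a `^ s)); apply.
rewrite le_eqVlt => /predU1P[a0 b0|a0 b0].
  have -> : b = 0 by apply/le_anti; rewrite b0 a0 ba.
  have q0 : q != 0 by rewrite gt_eqF//; lra.
  by rewrite -a0 addr0 subr0 normr0 (powR0 q0) addr0 mulr_ge0 ?powR_ge0.
have q10 : q - 1 != 0 by rewrite gt_eqF//; lra.
have x01 : 0 <= b / a <= 1.
  by rewrite divr_ge0 ?(ltW a0)//= ler_pdivrMr// mul1r.
have := clarkson_unit q2 sE x01.
have x0 : 0 <= 1 - b / a by move: x01 => /andP[_]; rewrite subr_ge0.
rewrite -(@ler_pM2l _ (a `^ q)) ?powR_gt0// mulrDr -!powRM ?(ltW a0)//; last first.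
  by case/andP: x01 => ? ?; lra.
have -> : a * (1 + b / a) = a + b by field; rewrite gt_eqF.
have -> : a * (1 - b / a) = a - b by field; rewrite gt_eqF.
rewrite ger0_norm ?subr_ge0// => /le_trans; apply.
rewrite mulrCA ler_pM2l//.
have -> : a `^ q = (a `^ s) `^ (q - 1) by rewrite -powRrM sE divfK.
rewrite -powRM ?powR_ge0//; last by rewrite addr_ge0 ?powR_ge0.
have ba0 : 0 <= b / a by case/andP: x01.
have -> : b `^ s = a `^ s * (b / a) `^ s.
  by rewrite -(powRM s (ltW a0) ba0) [a * _]mulrC divfK ?gt_eqF.
by rewrite mulrDr mulr1.
Qed.

Lemma normcX2 (R : realType) (z : R[i]) :
  (normc z) ^+ 2 = complex.Re z ^+ 2 + complex.Im z ^+ 2.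
Proof. by case: z => a b /=; rewrite sqr_sqrtr// addr_ge0 ?sqr_ge0. Qed.

(** The squared moduli of [a + b] and [a - b] are [A ^+ 2 + B ^+ 2] plus and minus a cross term [w]
    with [|w| <= 2 * (A * B)]. As [q / 2 >= 1], [powRD_symm_le] shows that the left side is largest
    when the cross term is extremal, which is the case of nonnegative reals. *)
Lemma clarkson_complex (R : realType) (q s : R) (a b : R[i]) :
  2 <= q -> s = q / (q - 1) ->
  normc (a + b) `^ q + normc (a - b) `^ q <=
  2 * (normc a `^ s + normc b `^ s) `^ (q - 1).
Proof.
move=> q2 sE.
have A0 := normc_ge0 a; have B0 := normc_ge0 b.
apply: le_trans (clarkson_nonneg q2 sE A0 B0).
have pow2 (z : R) : 0 <= z -> z `^ q = (z ^+ 2) `^ (q / 2).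
  move=> z0; rewrite -powR_mulrn// -powRrM; congr (_ `^ _).
  by rewrite mulrC divfK.
rewrite !pow2 ?normc_ge0 ?addr_ge0// real_normK ?num_real// !normcX2.
set A := normc a in A0 *; set B := normc b in B0 *.
pose w := 2 * (complex.Re a * complex.Re b + complex.Im a * complex.Im b).
have A2 : A ^+ 2 = complex.Re a ^+ 2 + complex.Im a ^+ 2 by exact: normcX2.
have B2 : B ^+ 2 = complex.Re b ^+ 2 + complex.Im b ^+ 2 by exact: normcX2.
have -> : complex.Re (a + b) ^+ 2 + complex.Im (a + b) ^+ 2 = A ^+ 2 + B ^+ 2 + w.
  by rewrite complex_ReD complex_ImD A2 B2 /w; ring.
have -> : complex.Re (a - b) ^+ 2 + complex.Im (a - b) ^+ 2 = A ^+ 2 + B ^+ 2 - w.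
  rewrite complex_ReD complex_ImD A2 B2 /w.
  by case: (a) => ? ?; case: (b) => ? ? /=; ring.
have -> : (A + B) ^+ 2 = A ^+ 2 + B ^+ 2 + 2 * (A * B) by ring.
have -> : (A - B) ^+ 2 = A ^+ 2 + B ^+ 2 - 2 * (A * B) by ring.
apply: powRD_symm_le; [by lra| |].
  rewrite -[leRHS]ger0_norm ?mulr_ge0//.
  rewrite -ler_sqr ?nnegrE ?normr_ge0// !real_normK ?num_real//.
  rewrite -subr_ge0.
  have -> : (2 * (A * B)) ^+ 2 = 4 * (A ^+ 2 * B ^+ 2) by ring.
  (* Lagrange's identity, which gives the Cauchy-Schwarz inequality in the plane. *)
  rewrite A2 B2 (_ : _ - _ =
    4 * (complex.Re a * complex.Im b - complex.Im a * complex.Re b) ^+ 2).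
    by rewrite mulr_ge0 ?sqr_ge0.
  by rewrite /w; ring.
by rewrite -subr_ge0 (_ : _ - _ = (A - B) ^+ 2) ?sqr_ge0//; ring.
Qed.

(** Hölder's inequality with exponents [t / (t - 1)] and [t], the case [t = 1] apart. The left side
    is linear in [x] and [y], so it can be integrated term by term. *)
Lemma powRD_hoelder (R : realType) (t a b x y : R) :
  1 <= t -> 0 <= a -> 0 <= b -> 0 <= x -> 0 <= y ->
  a `^ (t - 1) * x + b `^ (t - 1) * y <=
  (a `^ t + b `^ t) `^ (1 - t^-1) * (x `^ t + y `^ t) `^ t^-1.
Proof.
move=> + a0 b0 x0 y0; rewrite le_eqVlt => /predU1P[<-|t1].
  by rewrite subrr invr1 subrr !powRr0 !mul1r !powRr1 ?addr_ge0 ?powR_ge0.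
have t0 : 0 < t by lra.
have t10 : 0 < t - 1 by lra.
have := @hoelder2 R (a `^ (t - 1)) (b `^ (t - 1)) x y (t / (t - 1)) t.
rewrite !powR_ge0 divr_gt0// -!powRrM invf_div.
have -> : (t - 1) * (t / (t - 1)) = t by rewrite mulrC divfK ?gt_eqF.
have -> : (t - 1) / t = 1 - t^-1 by rewrite mulrBl divff ?gt_eqF// mul1r.
by apply => //; rewrite subrK.
Qed.

(** * Clarkson's inequality in L_p *)

(** The two uses of Minkowski's inequality, with exponents [t = q / p] and [k = p / s], are carried
    out by duality: Hölder on the left and Radon on the right turn the hypothesis into a pointwise
    inequality between linear combinations of [p]-th powers. The weights are built from the norms
    themselves, so nothing is lost after integration. *)
Lemma clarkson_integral d (T : measurableType d) (R : realType)
    (mu : {measure set T -> \bar R}) (p q s : R) (u v x y : T -> R)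
    (Nu Nv Nx Ny : R) :
  2 <= q -> s = q / (q - 1) -> s <= p -> p <= q ->
  measurable_fun [set: T] u -> measurable_fun [set: T] v ->
  measurable_fun [set: T] x -> measurable_fun [set: T] y ->
  (forall t, 0 <= u t) -> (forall t, 0 <= v t) ->
  (forall t, 0 <= x t) -> (forall t, 0 <= y t) ->
  (\int[mu]_t (u t `^ p)%:E = (Nu `^ p)%:E)%E ->
  (\int[mu]_t (v t `^ p)%:E = (Nv `^ p)%:E)%E ->
  (\int[mu]_t (x t `^ p)%:E = (Nx `^ p)%:E)%E ->
  (\int[mu]_t (y t `^ p)%:E = (Ny `^ p)%:E)%E ->
  0 < Nx -> 0 < Ny ->
  (forall t, u t `^ q + v t `^ q <= 2 * (x t `^ s + y t `^ s) `^ (q - 1)) ->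
  Nu `^ q + Nv `^ q <= 2 * (Nx `^ s + Ny `^ s) `^ (q - 1).
Proof.
move=> q2 sE sp pq mu_ mv mx my u0 v0 x0 y0 Iu Iv Ix Iy Nx0 Ny0 uvxy.
have q0 : 0 < q by lra.
have s0 : 0 < s by rewrite sE divr_gt0//; lra.
have p0 : 0 < p by exact: lt_le_trans sp.
have pn0 : p != 0 by rewrite gt_eqF.
have sn0 : s != 0 by rewrite gt_eqF.
pose t := q / p; have t1 : 1 <= t by rewrite ler_pdivlMr// mul1r.
pose k := p / s; have k1 : 1 <= k by rewrite ler_pdivlMr// mul1r.
have pt : p * t = q by rewrite /t mulrC divfK.
have sk : s * k = p by rewrite /k mulrC divfK.
have q1t : (q - 1) * t^-1 = k.
  by rewrite /t /k invf_div sE; field; rewrite !gt_eqF//; lra.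
have t0 : 0 < t by lra.
have k0 : 0 < k by lra.
clearbody t k.
set M := Nu `^ q + Nv `^ q.
have M0 : 0 <= M by rewrite addr_ge0 ?powR_ge0.
set A := Nx `^ s; set B := Ny `^ s.
have AkE : Nx `^ p = A `^ k by rewrite /A -powRrM sk.
have BkE : Ny `^ p = B `^ k by rewrite /B -powRrM sk.
have A0 : 0 < A by rewrite powR_gt0.
have B0 : 0 < B by rewrite powR_gt0.
clearbody A B.
have [->|Mn0] := eqVneq M 0; first by rewrite mulr_ge0// powR_ge0.
have {}M0 : 0 < M by rewrite lt_neqAle eq_sym Mn0.
set a := Nu `^ p in Iu; set b := Nv `^ p in Iv.
have abE : a `^ t + b `^ t = M by rewrite /a /b -!powRrM pt.
have a0 : 0 <= a by rewrite powR_ge0.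
have b0 : 0 <= b by rewrite powR_ge0.
clearbody M a b.
(* The product of the constants left by Hölder, by the scalar inequality raised to [t^-1], and by
   Radon with weights [A] and [B]; the integrated right side is [C * (A + B)]. *)
pose C := M `^ (1 - t^-1) * (2 `^ t^-1 * (A + B) `^ (k - 1)).
have CE : C = M `^ (1 - t^-1) * (2 `^ t^-1 * (A + B) `^ (k - 1)) by [].
have C0 : 0 <= C by rewrite !mulr_ge0 ?powR_ge0.
clearbody C.
have pointwise w : a `^ (t - 1) * u w `^ p + b `^ (t - 1) * v w `^ p <=
    C / A `^ (k - 1) * x w `^ p + C / B `^ (k - 1) * y w `^ p.
  have := powRD_hoelder t1 a0 b0 (powR_ge0 (u w) p) (powR_ge0 (v w) p).
  rewrite abE -!(powRrM _ p t) pt => /le_trans; apply.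
  have -> : C / A `^ (k - 1) * x w `^ p + C / B `^ (k - 1) * y w `^ p =
      M `^ (1 - t^-1) * (2 `^ t^-1 * ((A + B) `^ (k - 1) *
        (x w `^ p / A `^ (k - 1) + y w `^ p / B `^ (k - 1)))).
    by rewrite CE; ring.
  rewrite ler_wpM2l ?powR_ge0//.
  apply: (@le_trans _ _ (2 `^ t^-1 * (x w `^ s + y w `^ s) `^ k)).
    have -> : 2 `^ t^-1 * (x w `^ s + y w `^ s) `^ k =
        (2 * (x w `^ s + y w `^ s) `^ (q - 1)) `^ t^-1.
      by rewrite powRM ?powR_ge0// -powRrM q1t.
    rewrite ge0_ler_powR ?nnegrE ?invr_ge0 ?(ltW t0)//.
      by rewrite addr_ge0 ?powR_ge0.
    by rewrite mulr_ge0 ?powR_ge0.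
  rewrite ler_wpM2l ?powR_ge0//.
  have := powRD_jensen k1 A0 B0 (powR_ge0 (x w) s) (powR_ge0 (y w) s).
  by rewrite -!(powRrM _ s k) sk.
have mpow (f : T -> R) : measurable_fun [set: T] f ->
    measurable_fun [set: T] (fun w => (f w `^ p)%:E).
  by move=> mf; apply/measurable_EFinP; apply: (measurableT_comp (measurable_powR _)).
have int_lin (f g : T -> R) (c e F G : R) :
    measurable_fun [set: T] f -> measurable_fun [set: T] g -> 0 <= c -> 0 <= e ->
    (\int[mu]_t (f t `^ p)%:E = F%:E)%E -> (\int[mu]_t (g t `^ p)%:E = G%:E)%E ->
    (\int[mu]_t (c * f t `^ p + e * g t `^ p)%:E = (c * F + e * G)%:E)%E.
  move=> mf mg c0 e0 If Ig.
  under eq_integral do rewrite EFinD !EFinM.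
  rewrite ge0_integralD//=; first last.
  - by apply: measurable_funeM; exact: mpow.
  - by move=> w _; rewrite -EFinM lee_fin mulr_ge0 ?powR_ge0.
  - by apply: measurable_funeM; exact: mpow.
  - by move=> w _; rewrite -EFinM lee_fin mulr_ge0 ?powR_ge0.
  rewrite !ge0_integralZl_EFin//; try exact: mpow; last 2 first.
  - by move=> w _; rewrite lee_fin powR_ge0.
  - by move=> w _; rewrite lee_fin powR_ge0.
  by rewrite If Ig -!EFinM -EFinD.
have mlin (f g : T -> R) (c e : R) :
    measurable_fun [set: T] f -> measurable_fun [set: T] g ->
    measurable_fun [set: T] (fun w => (c * f w `^ p + e * g w `^ p)%:E).
  move=> /mpow/measurable_EFinP mf /mpow/measurable_EFinP mg.
  by apply/measurable_EFinP; apply: measurable_funD; apply: measurable_funM.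
have CA0 : 0 <= C / A `^ (k - 1) by rewrite divr_ge0 ?powR_ge0.
have CB0 : 0 <= C / B `^ (k - 1) by rewrite divr_ge0 ?powR_ge0.
have : (\int[mu]_w (a `^ (t - 1) * u w `^ p + b `^ (t - 1) * v w `^ p)%:E <=
    \int[mu]_w (C / A `^ (k - 1) * x w `^ p + C / B `^ (k - 1) * y w `^ p)%:E)%E.
  apply: ge0_le_integral => //.
  - by move=> w _; rewrite lee_fin addr_ge0// mulr_ge0 ?powR_ge0.
  - exact: mlin.
  - exact: mlin.
  - by move=> w _; rewrite lee_fin.
rewrite (int_lin _ _ _ _ _ _ mu_ mv _ _ Iu Iv) ?powR_ge0//.
rewrite (int_lin _ _ _ _ _ _ mx my CA0 CB0 Ix Iy) lee_fin AkE BkE.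
have powRS (c e : R) : 0 < e -> 0 <= c -> c `^ (e - 1) * c = c `^ e.
  by move=> e0 c0; rewrite mulrC mulr_powRB1.
have simp (c : R) : 0 < c -> C / c `^ (k - 1) * c `^ k = C * c.
  move=> c0; rewrite -(powRS c k k0 (ltW c0)) mulrA divfK// gt_eqF// powR_gt0//.
rewrite (powRS a t t0 a0) (powRS b t t0 b0) abE !simp// -mulrDr CE.
have -> : M `^ (1 - t^-1) * (2 `^ t^-1 * (A + B) `^ (k - 1)) * (A + B) =
    M `^ (1 - t^-1) * (2 `^ t^-1 * (A + B) `^ k).
  by rewrite -!mulrA (powRS (A + B) k k0)// addr_ge0 ?ltW.
have -> : M `^ (1 - t^-1) = M / M `^ t^-1.
  by rewrite (@powRB _ M 1 t^-1) ?(gt_eqF M0) ?implybT// (powRr1 (ltW M0)).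
rewrite mulrAC ler_pdivlMr ?powR_gt0// ler_pM2l// => MtM.
have : (M `^ t^-1) `^ t <= (2 `^ t^-1 * (A + B) `^ k) `^ t.
  by rewrite ge0_ler_powR ?nnegrE ?mulr_ge0 ?powR_ge0// ltW.
rewrite powRM ?powR_ge0// -!powRrM mulVf ?gt_eqF// !powRr1 ?(ltW M0)//.
have -> // : k * t = q - 1.
by rewrite -q1t -mulrA mulVf ?gt_eqF// mulr1.
Qed.

Section cLspace_clarkson.
Context d (T : measurableType d) (R : realType).
Variables (mu : {measure set T -> \bar R}) (r : R) (r1 : (1 <= r%:E)%E).

Lemma integral_normc_powR (f : cLfunType mu r1) :
  (\int[mu]_t (normc (f t) `^ r)%:E =
    (complex.Re `|\pi_(cLspace mu r1)%qT f| `^ r)%:E)%E.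
Proof.
have r0 : r != 0 by rewrite gt_eqF// (lt_le_trans ltr01).
rewrite -[`|_|]/(cLspace_norm _) cLspace_normE /=.
rewrite -[RHS]poweR_EFin fineK; last exact: cLnorm_fin_num.
rewrite /cLnorm (poweR_Lnorm _ _ r0).
by apply: eq_integral => t _ /=; rewrite ger0_norm ?normc_ge0.
Qed.

(** Nonzero classes have positive norms, as the division by [A] and [B] in Radon's inequality
    requires; zero vectors are treated in [clarkson_unit_ball]. *)
Lemma clarkson_cLspace (q s : R) (x y : cLspace mu r1) :
  2 <= q -> s = q / (q - 1) -> s <= r -> r <= q ->
  x != 0 -> y != 0 ->
  complex.Re `|x + y| `^ q + complex.Re `|x - y| `^ q <=
  2 * (complex.Re `|x| `^ s + complex.Re `|y| `^ s) `^ (q - 1).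
Proof.
move=> q2 sE sr rq.
have norm_gt0 (z : cLspace mu r1) : z != 0 -> 0 < complex.Re `|z|.
  by rewrite -normr_gt0 ltcE /= => /andP[].
move=> /norm_gt0 + /norm_gt0.
rewrite -[x]reprK -[y]reprK; move: (repr x) (repr y) => f g.
have -> : (\pi_(cLspace mu r1) f + \pi_(cLspace mu r1) g)%qT =
  \pi_(cLspace mu r1)%qT (f + g) by rewrite !piE.
have -> : (\pi_(cLspace mu r1) f - \pi_(cLspace mu r1) g)%qT =
  \pi_(cLspace mu r1)%qT (f - g) by rewrite !piE.
move=> f0 g0.
apply: (clarkson_integral q2 sE sr rq _ _ _ _ _ _ _ _
  (integral_normc_powR (f + g)) (integral_normc_powR (f - g))
  (integral_normc_powR f) (integral_normc_powR g)) => //.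
- exact/measurable_normc/cLfun_measurable.
- exact/measurable_normc/cLfun_measurable.
- exact/measurable_normc/cLfun_measurable.
- exact/measurable_normc/cLfun_measurable.
- by move=> t; exact: normc_ge0.
- by move=> t; exact: normc_ge0.
- by move=> t; exact: normc_ge0.
- by move=> t; exact: normc_ge0.
by move=> t; exact: clarkson_complex.
Qed.

End cLspace_clarkson.

(** * The polarization formula *)

Section multilinear_theory.
Context {R : realType} (m : nat) (X : normedModType R[i]).
Variable L : ('I_m -> X) -> R[i].
Hypothesis mL : multilinear L.

Lemma multilinear_scale (c : 'I_m -> R[i]) (v : 'I_m -> X) :
  L (fun j => c j *: v j) = (\prod_j c j) * L v.
Proof.
have step (k : nat) : (k <= m)%N ->
    L (fun j => if (j < k)%N then c j *: v j else v j) =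
    (\prod_(j < m | (j < k)%N) c j) * L v.
  elim: k => [_|k ih km]; first by rewrite big_pred0// mul1r.
  pose i := Ordinal km; rewrite (bigD1 i)//= -mulrA.
  rewrite (eq_bigl (fun j : 'I_m => (j < k)%N)); last first.
    by move=> j; rewrite ltnS -(inj_eq val_inj) /= ltn_neqAle andbC.
  rewrite -ih ?(ltnW km)//.
  set w := fun j : 'I_m => if (j < k)%N then c j *: v j else v j.
  have -> : (fun j : 'I_m => if (j < k.+1)%N then c j *: v j else v j) =
      dfwith w i (c i *: v i + 0).
    apply/funext => j; case: dfwithP => [|j' ij]; first by rewrite /= ltnSn addr0.
    rewrite /w ltnS leq_eqVlt; case: eqVneq => //= jk.
    by case/eqP: ij; apply/val_inj.
  rewrite mL.
  have -> : dfwith w i (v i) = w.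
    by apply/funext => j; case: dfwithP => //; rewrite /w ltnn.
  suff -> : L (dfwith w i 0) = 0 by rewrite addr0.
  apply: (addrI (L (dfwith w i 0))).
  by have := mL w i 1 0 0; rewrite scaler0 !addr0 mul1r => <-.
rewrite -[LHS](_ : L (fun j => if (j < m)%N then c j *: v j else v j) = _); last first.
  by congr L; apply/funext => j; rewrite ltn_ord.
by rewrite step//; congr (_ * _); apply: eq_bigl => j; rewrite ltn_ord.
Qed.

Lemma multilinear_dfwith_sum (I : finType) (w : 'I_m -> X) i (F : I -> X) :
  L (dfwith w i (\sum_l F l)) = \sum_l L (dfwith w i (F l)).
Proof.
have LD x y : L (dfwith w i (x + y)) = L (dfwith w i x) + L (dfwith w i y).
  by rewrite -[x in LHS]scale1r mL mul1r.
apply: (big_morph (fun x => L (dfwith w i x))) => //.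
by apply: (addrI (L (dfwith w i 0))); rewrite -LD !addr0.
Qed.

(* All the coordinates of [f] are summed over from the start, so that
   expanding one entry is an averaging over translations of that coordinate. *)
Lemma multilinear_expand (n : nat) (a : 'I_m -> 'I_n.+1 -> X) :
  L (fun j => \sum_l a j l) =
  \sum_(f : {ffun 'I_m -> 'I_n.+1}) L (fun j => a j (f j)).
Proof.
pose G k (f : {ffun 'I_m -> 'I_n.+1}) :=
  L (fun j => if (j < k)%N then a j (f j) else \sum_l a j l).
(* In [G k] only the first [k] entries are expanded, so each of their choices is counted
   [n.+1 ^ (m - k)] times; the powers of [n.+1] balance this. *)
have step k : (k <= m)%N ->
    n.+1%:R ^+ k * \sum_f G k f = n.+1%:R ^+ m * L (fun j => \sum_l a j l).
  elim: k => [_|k ih km].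
    rewrite expr0 mul1r (eq_bigr (fun=> L (fun j => \sum_l a j l)))//.
    rewrite sumr_const card_ffun !card_ord.
    by rewrite -[LHS]mulr_natl natrX.
  rewrite -ih ?(ltnW km)// exprSr -mulrA; congr (_ * _).
  pose i := Ordinal km.
  pose shift (l : 'I_n.+1) : {ffun 'I_m -> 'I_n.+1} :=
    [ffun j => if j == i then l else 0].
  transitivity (\sum_(l < n.+1) \sum_(f : {ffun 'I_m -> 'I_n.+1}) G k.+1 (f + shift l)).
    rewrite [RHS](eq_bigr (fun=> \sum_f G k.+1 f)); last first.
      by move=> l _; rewrite [RHS](reindex_inj (addIr (shift l))).
    by rewrite sumr_const card_ord mulr_natl.
  rewrite exchange_big; apply: eq_bigr => f _ /=.
  (* Addition in ['I_n.+1] is modulo [n.+1]; after this change of [l], coordinate [i] of the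
     translate is exactly [l]. *)
  rewrite (reindex_inj (addIr (- f i))) /=.
  set w := fun j : 'I_m => if (j < k)%N then a j (f j) else \sum_l a j l.
  have -> : G k f = L (dfwith w i (\sum_l a i l)).
    congr L; apply/funext => j; case: dfwithP => [|//].
    by rewrite /= ltnn.
  rewrite multilinear_dfwith_sum; apply: eq_bigr => l _; congr L.
  apply/funext => j; rewrite !ffunE; case: dfwithP => [|j' ij].
    by rewrite /= ltnSn eqxx addrC subrK.
  rewrite [j' == i]eq_sym (negbTE ij) addr0 /w ltnS leq_eqVlt.
  by case: eqVneq => //= jk; case/eqP: ij; apply/val_inj.
have := step m (leqnn m).
have n0 : (n.+1%:R : R[i]) ^+ m != 0 by rewrite expf_neq0// pnatr_eq0.
move=> /(mulfI n0) <-; apply: eq_bigr => f _; congr L.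
by apply/funext => j; rewrite ltn_ord.
Qed.

End multilinear_theory.

(** * Orthogonality of signs and the polarization formula *)

Section rademacher.
Variable m : nat.
Implicit Types (e : {ffun 'I_m -> bool}) (i : 'I_m).

Definition flip i e : {ffun 'I_m -> bool} :=
  [ffun j => if j == i then ~~ e j else e j].

Lemma flipK i : involutive (flip i).
Proof. by move=> e; apply/ffunP => j; rewrite !ffunE; case: eqP; rewrite ?negbK. Qed.

(** If [f] is injective it permutes the indices, the two products agree and every term is [1].
    Otherwise [f] misses some [i], and flipping the sign at [i] negates the first product only, so
    the sum is its own opposite. *)
Lemma sum_signs (R : numDomainType) (f : {ffun 'I_m -> 'I_m}) :
  \sum_(e : {ffun 'I_m -> bool}) (\prod_i (-1) ^+ e i) * (\prod_j (-1) ^+ e (f j)) =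
  (if injectiveb f then 2 ^+ m else 0 : R).
Proof.
case: injectiveP => [finj|fninj].
  rewrite (eq_bigr (fun=> 1)) => [|e _].
    by rewrite sumr_const card_ffun card_bool card_ord -natrX.
  rewrite -(reindex_inj finj (P := xpredT) (F := fun i => (-1) ^+ e i)) /=.
  by rewrite -big_split big1// => i _ /=; rewrite -expr2 sqrr_sign.
have [i fi] : exists i, i \notin codom f.
  apply/existsP; rewrite -[X in is_true X]negbK negb_exists.
  apply/negP => /forallP cf.
  apply: fninj; apply/injectiveP.
  apply: (leq_size_uniq (enum_uniq 'I_m)); last by rewrite size_codom cardE.
  by move=> i _; have := cf i; rewrite negbK.
set S := LHS; suff : S = - S by move/eqP; rewrite -addr_eq0 -mulr2n mulrn_eq0 => /eqP.
rewrite {1}/S (reindex_inj (inv_inj (flipK i))) /= -sumrN; apply: eq_bigr => e _.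
rewrite -mulNr; congr (_ * _).
  rewrite (bigD1 i)//= [in RHS](bigD1 i)//= ffunE eqxx signrN mulNr.
  by congr (- (_ * _)); apply: eq_bigr => j ji; rewrite ffunE (negbTE ji).
apply: eq_bigr => j _; rewrite ffunE; case: eqP => // fji.
by case/negP: fi; rewrite -fji codom_f.
Qed.

End rademacher.

(** Expanding by multilinearity gives a sum over all index maps [f]; [sum_signs] keeps only the
    permutations, and by symmetry each of these contributes [2 ^+ m * L v]. *)
Lemma polarization_formula (R : realType) (m : nat) (X : normedModType R[i])
    (L : ('I_m -> X) -> R[i]) (v : 'I_m -> X) :
  (0 < m)%N -> multilinear L -> Defs.symmetric_form L ->
  \sum_(e : {ffun 'I_m -> bool}) (\prod_i (-1) ^+ e i) *
    assoc_poly L (\sum_i (-1) ^+ e i *: v i) = 2 ^+ m * m`!%:R * L v.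
Proof.
case: m L v => // n L v _ mL sL.
transitivity (\sum_(e : {ffun 'I_n.+1 -> bool})
    \sum_(f : {ffun 'I_n.+1 -> 'I_n.+1})
    (\prod_i (-1) ^+ e i) * (\prod_j (-1) ^+ e (f j)) * L (v \o f)).
  apply: eq_bigr => e _; rewrite /assoc_poly.
  rewrite (multilinear_expand mL (fun _ i => (-1) ^+ e i *: v i)) mulr_sumr.
  apply: eq_bigr => f _.
  by rewrite -mulrA -(multilinear_scale mL (fun j => (-1) ^+ e (f j)) (v \o f)).
rewrite exchange_big /=.
rewrite (eq_bigr (fun f : {ffun 'I_n.+1 -> 'I_n.+1} =>
    if injectiveb f then 2 ^+ n.+1 * L v else 0)) => [|f _].
  rewrite -big_mkcond sumr_const /= -[LHS]mulr_natr mulrAC; congr (_ * _%:R * _).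
  have := card_inj_ffuns 'I_n.+1 'I_n.+1.
  by rewrite !card_ord ffactnn cardsE.
rewrite -mulr_suml sum_signs; case: injectiveP => [finj|_]; last by rewrite mul0r.
congr (_ * _); rewrite -[RHS](sL (perm finj)); congr L.
by apply/funext => j; rewrite /= permE.
Qed.

(** * Random signs and the polarization constant *)

Lemma normc_normr (R : realType) (z : R[i]) : `|z| = (normc z)%:C%C.
Proof. by case: z. Qed.

Section real_norm.
Context {R : realType} {X : normedModType R[i]}.
Implicit Types x y : X.

(** The norm of [X] has values in [R[i]], while real powers need an element of [R]. *)
Definition renorm x : R := complex.Re `|x|.

Lemma renormE x : `|x| = (renorm x)%:C%C.
Proof.
rewrite /renorm; have := normr_ge0 x.
by case: `|x| => a b; rewrite lecE /= => /andP[/eqP ->].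
Qed.

Lemma renorm_ge0 x : 0 <= renorm x.
Proof. by rewrite -lecR -renormE normr_ge0. Qed.

Lemma renormZ (a : R[i]) x : renorm (a *: x) = normc a * renorm x.
Proof.
suff [] : (renorm (a *: x))%:C%C = (normc a * renorm x)%:C%C by [].
by rewrite rmorphM /= -!renormE normrZ normc_normr.
Qed.

Lemma renormN x : renorm (- x) = renorm x.
Proof. by rewrite /renorm normrN. Qed.

Lemma renorm0 : renorm 0 = 0.
Proof. by rewrite /renorm normr0. Qed.

Lemma renorm_sign (b : bool) x : renorm ((-1) ^+ b *: x) = renorm x.
Proof. by rewrite /renorm normrZ normr_sign mul1r. Qed.

Lemma ler_renormD x y : renorm (x + y) <= renorm x + renorm y.
Proof. by rewrite -lecR rmorphD /= -!renormE ler_normD. Qed.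

Lemma renorm_sum (I : finType) (P : pred I) (F : I -> X) :
  renorm (\sum_(i | P i) F i) <= \sum_(i | P i) renorm (F i).
Proof.
elim/big_rec2: _ => [|i u v _ h]; first by rewrite renorm0.
by rewrite (le_trans (ler_renormD _ _))// lerD2l.
Qed.

End real_norm.

(** The predicate [P] provides the partial sums of the induction, all over the same space of
    signs. *)
Definition signed_sum (R : realType) (X : normedModType R[i]) (m : nat)
    (v : 'I_m -> X) (P : pred 'I_m) (e : {ffun 'I_m -> bool}) : X :=
  \sum_(i | P i) (-1) ^+ e i *: v i.

Lemma polarization_constant_le (R : realType) (m : nat) (X : normedModType R[i])
    (K : R) : (0 < m)%N -> 0 < K ->
  (forall v : 'I_m -> X, (forall i, `|v i| <= 1) ->
    \sum_e renorm (signed_sum v xpredT e) ^+ m <= 2 ^+ m * K) ->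
  (polarization_constant m X <= (K / m`!%:R)%:E)%E.
Proof.
move=> m0 K0 hK.
have fm0 : 0 < (m`!%:R : R) by rewrite ltr0n fact_gt0.
apply: ereal_inf_lbound; exists (K / m`!%:R) => //; split; first by rewrite divr_gt0.
move=> L [_ mL sL].
have L0 : assoc_poly L 0 = 0.
  have := multilinear_scale mL (fun=> 0) (fun=> 0).
  rewrite (_ : (fun _ => _) = fun=> 0); last by apply/funext => i; rewrite scale0r.
  by rewrite /assoc_poly => ->; rewrite prodr_const card_ord expr0n eqn0Ngt m0 mul0r.
have ubP z : `|z| <= 1 -> ((normc (assoc_poly L z))%:E <= poly_norm (assoc_poly L))%E.
  by move=> z1; apply: ereal_sup_ubound; exists z.
(* An infinite polynomial norm makes the bound trivial, and [-oo] is excluded by the value at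
   [0]. *)
case: (poly_norm _) ubP => [b| |] ubP; last 2 first.
- by rewrite gt0_muley ?leey// lte_fin divr_gt0.
- by have := ubP 0; rewrite normr0 => /(_ ler01).
have b0 : 0 <= b by have := ubP 0; rewrite normr0 L0 lee_fin Normc.normc0 => /(_ ler01).
have hom y : `|assoc_poly L y| <= (b * renorm y ^+ m)%:C%C.
  have [->|y0] := eqVneq y 0.
    by rewrite L0 normr0 lecR mulr_ge0 ?exprn_ge0 ?renorm_ge0.
  have ny0 : `|y| != 0 by rewrite normr_eq0.
  have -> : assoc_poly L y = `|y| ^+ m * assoc_poly L (`|y|^-1 *: y).
    have := multilinear_scale mL (fun=> `|y|) (fun=> `|y|^-1 *: y).
    rewrite prodr_const card_ord => <-; congr L; apply/funext => i.
    by rewrite scalerA divff// scale1r.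
  rewrite normrM normrX normr_id rmorphM rmorphXn /= -renormE mulrC.
  rewrite ler_wpM2r ?exprn_ge0// normc_normr lecR -lee_fin; apply: ubP.
  by rewrite normrZ normfV normr_id mulVf.
rewrite /form_norm; apply: ge_ereal_sup => _ [v v1 <-]; rewrite -EFinM lee_fin.
have -> : K / m`!%:R * b = b * K / m`!%:R by rewrite mulrAC [K * b]mulrC.
rewrite ler_pdivlMr//.
have : `|2 ^+ m * m`!%:R * L v| <= (b * (2 ^+ m * K))%:C%C.
  rewrite -polarization_formula//; apply: le_trans (ler_norm_sum _ _ _) _.
  apply: (@le_trans _ _ (\sum_e (b * renorm (signed_sum v xpredT e) ^+ m)%:C%C)).
    apply: ler_sum => e _; rewrite normrM normr_prod big1 ?mul1r; first exact: hom.
    by move=> i _; rewrite normr_sign.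
  by rewrite -rmorph_sum lecR -mulr_sumr ler_wpM2l// hK.
rewrite !normrM normrX !normr_nat normc_normr.
have -> : 2 ^+ m * m`!%:R * (normc (L v))%:C%C = (2 ^+ m * m`!%:R * normc (L v))%:C%C.
  by rewrite !rmorphM rmorphXn !rmorph_nat.
rewrite lecR [b * _]mulrCA -mulrA ler_pM2l ?exprn_gt0//.
by rewrite [_%:R * _]mulrC.
Qed.

Lemma polarization_constant_trivial (R : realType) (m : nat)
    (X : normedModType R[i]) : (0 < m)%N ->
  (polarization_constant m X <= (m%:R ^+ m / m`!%:R)%:E)%E.
Proof.
move=> m0; apply: polarization_constant_le => //; first by rewrite exprn_gt0 ?ltr0n.
move=> v v1.
have Sm e : renorm (signed_sum v xpredT e) <= m%:R.
  apply: le_trans (renorm_sum _ _) _.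
  rewrite -[in leRHS](card_ord m) -sumr_const; apply: ler_sum => i _.
  by rewrite renorm_sign -lecR -renormE v1.
apply: (@le_trans _ _ (\sum_(e : {ffun 'I_m -> bool}) m%:R ^+ m)).
  by apply: ler_sum => e _; rewrite lerXn2r ?nnegrE ?renorm_ge0.
by rewrite sumr_const card_ffun card_bool card_ord -[leLHS]mulr_natl natrX.
Qed.

(** * Moments of signed sums *)

Section rademacher_clarkson.
Context {R : realType} (X : normedModType R[i]) (q s : R).
Hypotheses (q2 : 2 <= q) (sE : s = q / (q - 1)).
Hypothesis clarkson : forall x y : X, x != 0 -> y != 0 ->
  renorm (x + y) `^ q + renorm (x - y) `^ q <=
  2 * (renorm x `^ s + renorm y `^ s) `^ (q - 1).

Let q0 : 0 < q. Proof. by rewrite (lt_le_trans _ q2). Qed.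
Let q10 : 0 < q - 1. Proof. by rewrite subr_gt0 (lt_le_trans _ q2)// ltr1n. Qed.
Let s0 : 0 < s. Proof. by rewrite sE divr_gt0. Qed.
Let sq : s * (q - 1) = q. Proof. by rewrite sE divfK// gt_eqF. Qed.

Lemma clarkson_unit_ball (x y : X) : renorm y <= 1 ->
  renorm (x + y) `^ q + renorm (x - y) `^ q <= 2 * (renorm x `^ s + 1) `^ (q - 1).
Proof.
move=> y1; have xs0 := powR_ge0 (renorm x) s.
have [->|x0] := eqVneq x 0.
  rewrite add0r sub0r renormN renorm0 powR0 ?gt_eqF// add0r powR1.
  have : renorm y `^ q <= 1 `^ q.
    by rewrite ge0_ler_powR ?nnegrE ?renorm_ge0// ltW.
  by rewrite powR1; lra.
have [->|y0] := eqVneq y 0.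
  rewrite addr0 subr0; have -> : renorm x `^ q = (renorm x `^ s) `^ (q - 1).
    by rewrite -powRrM sq.
  have : (renorm x `^ s) `^ (q - 1) <= (renorm x `^ s + 1) `^ (q - 1).
    by rewrite ge0_ler_powR ?nnegrE ?(ltW q10) ?addr_ge0 ?lerDl.
  by lra.
apply: le_trans (clarkson x0 y0) _; rewrite ler_pM2l//.
rewrite ge0_ler_powR ?nnegrE ?(ltW q10) ?addr_ge0 ?powR_ge0// lerD2l.
have : renorm y `^ s <= 1 `^ s.
  by rewrite ge0_ler_powR ?nnegrE ?renorm_ge0// ltW.
by rewrite powR1.
Qed.

Lemma sum_signed_sum_powR (m : nat) (v : 'I_m -> X) (k : nat) : (k <= m)%N ->
  (forall i, `|v i| <= 1) ->
  \sum_e renorm (signed_sum v (fun i : 'I_m => (i < k)%N) e) `^ q <=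
  2 ^+ m * k%:R `^ (q - 1).
Proof.
move=> + v1; elim: k => [_|k ih km].
  rewrite big1 ?mulr_ge0 ?exprn_ge0 ?powR_ge0// => e _.
  by rewrite /signed_sum big_pred0// renorm0 powR0 ?gt_eqF.
pose i := Ordinal km.
pose S e := signed_sum v (fun i : 'I_m => (i < k)%N) e.
have SE e : signed_sum v (fun i : 'I_m => (i < k.+1)%N) e = S e + (-1) ^+ e i *: v i.
  rewrite /S /signed_sum (bigD1 i)//= addrC; congr (_ + _); apply: eq_bigl => j.
  by rewrite ltnS -(inj_eq val_inj) /= ltn_neqAle andbC.
have Sflip e : S (flip i e) = S e.
  apply: eq_bigr => j jk; rewrite ffunE; case: eqP => // ji.
  by move: jk; rewrite ji /= ltnn.
(* Flipping the sign at [i] leaves [S] unchanged, so the sum can be averaged over both signs of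
   [v i], which produces the left side of Clarkson's inequality. *)
have pair : 2 * \sum_e renorm (S e + (-1) ^+ e i *: v i) `^ q =
    \sum_e (renorm (S e + (-1) ^+ e i *: v i) `^ q +
            renorm (S e - (-1) ^+ e i *: v i) `^ q).
  rewrite big_split /= mulr2n mulrDl !mul1r; congr (_ + _).
  rewrite (reindex_inj (inv_inj (flipK i))) /=; apply: eq_bigr => e _.
  by rewrite Sflip ffunE eqxx signrN scaleNr.
rewrite (eq_bigr (fun e => renorm (S e + (-1) ^+ e i *: v i) `^ q)); last first.
  by move=> e _; rewrite SE.
rewrite -(@ler_pM2l _ 2)// pair.
apply: (@le_trans _ _ (\sum_e 2 * (renorm (S e) `^ s + 1) `^ (q - 1))).
  apply: ler_sum => e _; apply: clarkson_unit_ball.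
  by rewrite renorm_sign -lecR -renormE v1.
rewrite -mulr_sumr ler_pM2l//.
have [k0|k0] := posnP k.
  rewrite k0 powR1 mulr1 (eq_bigr (fun=> 1)).
    by rewrite sumr_const card_ffun card_bool card_ord -natrX.
  move=> e _; rewrite /S /signed_sum k0 big_pred0// renorm0.
  by rewrite powR0 ?gt_eqF// add0r powR1.
have q11 : 1 <= q - 1 by move: q2; lra.
have kR0 : 0 < (k%:R : R) by rewrite ltr0n.
have k10 : 0 < (k%:R + 1 : R) by lra.
(* Radon with exponent [q - 1] and weights [k] and [1], the bounds for the [s]-th powers of [S e]
   and of the new vector. The weight [k] must be positive, hence the separate case [k = 0]. *)
apply: (@le_trans _ _ (\sum_e (k%:R + 1) `^ (q - 1 - 1) *
    (renorm (S e) `^ q / k%:R `^ (q - 1 - 1) + 1))).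
  apply: ler_sum => e _.
  have := powRD_jensen q11 kR0 ltr01 (powR_ge0 (renorm (S e)) s) ler01.
  by rewrite -(powRrM _ s) sq !powR1 divr1.
rewrite -mulr_sumr big_split /= -mulr_suml sumr_const.
rewrite card_ffun card_bool card_ord.
have -> : (k.+1%:R : R) `^ (q - 1) = (k%:R + 1) `^ (q - 1 - 1) * (k%:R + 1).
  by rewrite mulrC mulr_powRB1 ?natr1// ltW.
rewrite mulrCA ler_wpM2l ?powR_ge0// mulrDr mulr1 natrX lerD2r.
rewrite ler_pdivrMr ?powR_gt0// -mulrA mulr_powRB1 ?(ltW kR0)//.
exact/ih/ltnW.
Qed.

End rademacher_clarkson.

Lemma powR_le_tangent (R : realType) (r q z : R) : 0 < r -> r <= q -> 0 <= z ->
  z `^ r <= r / q * z `^ q + (1 - r / q).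
Proof.
move=> r0; rewrite le_eqVlt => /predU1P[<-|rq] z0.
  by rewrite divff ?gt_eqF// mul1r subrr addr0.
have q0 : 0 < q by exact: lt_trans rq.
have qr0 : 0 < q - r by rewrite subr_gt0.
have := @conjugate_powR R (z `^ r) 1 (q / r) (q / (q - r)).
rewrite powR_ge0 ler01 !divr_gt0// !invf_div => /(_ isT isT isT isT).
have -> : r / q + (q - r) / q = 1 by field; rewrite gt_eqF.
move=> /(_ erefl); rewrite powR1 mulr1 -powRrM [r * _]mulrC divfK ?gt_eqF//.
by rewrite mul1r mulrBl divff ?gt_eqF// [_ * (r / q)]mulrC.
Qed.

Lemma polarization_constant_clarkson (R : realType) (m : nat)
    (X : normedModType R[i]) (q s : R) :
  (2 <= m)%N -> m%:R <= q -> s = q / (q - 1) ->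
  (forall x y : X, x != 0 -> y != 0 ->
    renorm (x + y) `^ q + renorm (x - y) `^ q <=
    2 * (renorm x `^ s + renorm y `^ s) `^ (q - 1)) ->
  (polarization_constant m X <= (m%:R `^ (m%:R / s) / m`!%:R)%:E)%E.
Proof.
move=> m2 mq sE clarkson.
have m0 : (0 < m)%N by exact: ltnW.
have mR0 : 0 < (m%:R : R) by rewrite ltr0n.
have q2 : 2 <= q by apply: le_trans mq; rewrite ler_nat.
have q0 : 0 < q by rewrite (lt_le_trans _ q2).
apply: polarization_constant_le => //; first by rewrite powR_gt0.
move=> v v1; pose K : R := m%:R `^ s^-1.
have K0 : 0 < K by rewrite powR_gt0.
have Kq : K `^ q = m%:R `^ (q - 1).
  rewrite -powRrM sE invf_div; congr (_ `^ _).
  by rewrite divfK// gt_eqF.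
have Km : m%:R `^ (m%:R / s) = K ^+ m.
  by rewrite -powR_mulrn ?(ltW K0)// -powRrM mulrC.
have bound := sum_signed_sum_powR q2 sE clarkson (leqnn m) v1.
have {}bound : \sum_e renorm (signed_sum v xpredT e) `^ q <= 2 ^+ m * K `^ q.
  rewrite Kq; apply: le_trans bound; rewrite le_eqVlt; apply/orP; left; apply/eqP.
  apply: eq_bigr => e _; congr (renorm _ `^ _); apply: eq_bigl => i.
  by rewrite ltn_ord.
rewrite Km.
(* The tangent bound is applied to the norm divided by [K], whose [q]-th moment is at most [1]; the
   two coefficients then add up to [1]. *)
apply: (@le_trans _ _ (\sum_e K ^+ m * (m%:R / q *
    (renorm (signed_sum v xpredT e) `^ q / K `^ q) + (1 - m%:R / q)))).
  apply: ler_sum => e _; set z := renorm _.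
  have z0 : 0 <= z by exact: renorm_ge0.
  have := powR_le_tangent mR0 mq (divr_ge0 z0 (ltW K0)).
  rewrite powR_mulrn ?divr_ge0 ?(ltW K0)// expr_div_n.
  rewrite ler_pdivrMr ?exprn_gt0// [_ * K ^+ m]mulrC => /le_trans; apply.
  rewrite powRM ?invr_ge0 ?(ltW K0)// -[K^-1]powR_inv1 ?(ltW K0)//.
  by rewrite -powRrM mulN1r powRN.
rewrite -mulr_sumr [leRHS]mulrC ler_pM2l ?exprn_gt0//.
rewrite big_split /= sumr_const card_ffun card_bool card_ord.
rewrite -mulr_sumr -mulr_suml -[(1 - _) *+ _]mulr_natr natrX.
have mq0 : 0 <= m%:R / q by rewrite divr_ge0 ?ltW.
have : m%:R / q * ((\sum_e renorm (signed_sum v xpredT e) `^ q) / K `^ q) <=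
    m%:R / q * 2 ^+ m.
  by rewrite ler_wpM2l// ler_pdivrMr ?powR_gt0.
by lra.
Qed.

(** * The three ranges of [p] *)

Lemma polarization_constant_cLspace d (T : measurableType d) (R : realType)
    (mu : {measure set T -> \bar R}) (m : nat) (r : R) (r1 : (1 <= r%:E)%E)
    (q s : R) :
  (2 <= m)%N -> m%:R <= q -> s = q / (q - 1) -> s <= r -> r <= q ->
  (polarization_constant m (cLspace mu r1) <= (m%:R `^ (m%:R / s) / m`!%:R)%:E)%E.
Proof.
move=> m2 mq sE sr rq; apply: (polarization_constant_clarkson m2 mq sE) => x y x0 y0.
by apply: clarkson_cLspace => //; apply: le_trans mq; rewrite ler_nat.
Qed.

Lemma hoelder_conjugate_fin (R : realType) (r : R) : 1 < r ->
  hoelder_conjugate r%:E = (r / (r - 1))%:E.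
Proof.
move=> r1; rewrite /hoelder_conjugate /= eqe gt_eqF ?(lt_trans ltr01)//.
by rewrite -EFinD inver subr_eq0 gt_eqF.
Qed.

Theorem proposition10 (R : realType) (m : nat) (p : \bar R)
    (hm : (2 <= m)%N) (hp : (1 <= p)%E) :
  let m' := hoelder_conjugate (m%:R%:E : \bar R) in
  let p' := hoelder_conjugate p in
  [/\ ((p <= m')%E ->
        (polarization_constant_Lp m hp <=
          ((m%:R : R) `^ (m%:R / fine p) / (m`!)%:R)%R%:E)%E),
      ((m' <= p)%E -> (p <= m%:R%:E)%E ->
        (polarization_constant_Lp m hp <=
          ((m%:R : R) `^ (m%:R / fine m') / (m`!)%:R)%R%:E)%E) &
      ((m%:R%:E <= p)%E ->
        (polarization_constant_Lp m hp <=
          ((m%:R : R) `^ (m%:R / fine p') / (m`!)%:R)%R%:E)%E)].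
Proof.
move=> m' p'; rewrite {}/p'.
have m0 : (0 < m)%N by exact: ltnW.
have m2 : 2 <= (m%:R : R) by rewrite ler_nat.
have m1 : 1 < (m%:R : R) by rewrite ltr1n.
have m'E : m' = (m%:R / (m%:R - 1) : R)%:E by exact: hoelder_conjugate_fin.
have trivial_bound : (polarization_constant_Lp m hp <=
    ((m%:R : R) `^ (m%:R / 1) / (m`!)%:R)%R%:E)%E.
  apply: ge_ereal_sup => _ [d [T [mu ->]]].
  by rewrite divr1 powR_mulrn//; exact: polarization_constant_trivial.
rewrite m'E /=; case: p hp trivial_bound => [r| |//] hp trivial_bound.
(* At [p = 1] only the first range is possible, and its exponent is that of [trivial_bound]. *)
- have [r1|r1] := eqVneq r 1.
    split.
    - by move=> _ /=; rewrite [in m%:R / r]r1.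
    - move=> m'r; exfalso; move: m'r.
      by rewrite lee_fin r1 ler_pdivrMr ?subr_gt0// mul1r; lra.
    - by move=> mr; exfalso; move: mr; rewrite lee_fin r1; lra.
  have {}r1 : 1 < r by rewrite lt_neqAle eq_sym r1 -lee_fin.
  have bound (q s : R) : m%:R <= q -> s = q / (q - 1) -> s <= r -> r <= q ->
      (polarization_constant_Lp m hp <= (m%:R `^ (m%:R / s) / (m`!)%:R)%:E)%E.
    move=> mq sE sr rq; apply: ge_ereal_sup => _ [d [T [mu ->]]].
    exact: (polarization_constant_cLspace _ _ hm mq sE sr rq).
  rewrite hoelder_conjugate_fin//= !lee_fin.
  have r10 : r - 1 != 0 by rewrite gt_eqF// subr_gt0.
  split.
  (* Here [q] is the conjugate of [r], so [s = r]; moreover [r <= m' <= 2 <= m <= q]. The next two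
     ranges take [q = m] and [q = r]. *)
  - move=> rm; have rm' : m%:R <= r / (r - 1).
      move: rm; rewrite !ler_pdivlMr ?subr_gt0//; lra.
    apply: (bound (r / (r - 1))) => //.
      by field; rewrite r10 /=; apply/eqP; lra.
    apply: (le_trans _ rm'); apply: (le_trans _ m2); apply: (le_trans rm).
    by rewrite ler_pdivrMr ?subr_gt0//; lra.
  - by move=> ? ?; exact: (bound m%:R).
  - move=> mr; apply: (bound r) => //.
    by rewrite ler_pdivrMr ?subr_gt0//; move: m2 mr; nra.
(* At [p = +oo] the conjugate exponent is [1], and only the third range is possible. *)
- split => //.
Qed.
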